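(* Let $\lambda\in(0,1]$ and $-1\le B<A\le 0$. Then the function $v_\lambda(A,B,z)=\left(\dfrac{1+Az}{1+Bz}\right)^{\lambda}$ is stable with respect to $v_\lambda(0,B,z)=\dfrac{1}{(1+Bz)^{\lambda}}$; that is, for every $n\in\mathbb{N}$, $$\frac{s_n(v_\lambda(A,B,z))}{v_\lambda(A,B,z)}\prec\frac{1}{v_\lambda(0,B,z)},\qquad z\in\mathbb{D}.$$
   Context: $\mathbb{D}=\{z\in\mathbb{C}:|z|<1\}$, $\mathbb{N}=\{1,2,3,\dots\}$, and $\mathcal{A}_1$ is the class of analytic functions $f$ in $\mathbb{D}$ with $f(0)=1$. Powers are principal branches (value $1$ at $z=0$). For $f(z)=\sum_{k=0}^\infty a_kz^k$, the $n$-th partial sum is $s_n(f(z))=\sum_{k=0}^n a_kz^k$. For $f,g$ analytic in $\mathbb{D}$, $f\prec g$ ($f$ is subordinate to $g$) means there is an analytic $\omega:\mathbb{D}\to\mathbb{C}$ with $\omega(0)=0$ and $|\omega(z)|<1$ for all $z\in\mathbb{D}$ such that $f=g\circ\omega$. For $n\in\mathbb{N}$, $F\in\mathcal{A}_1$ is $n$-stable with respect to $G\in\mathcal{A}_1$ if $\frac{s_n(F(z))}{F(z)}\prec\frac{1}{G(z)}$ in $\mathbb{D}$; $F$ is stable with respect to $G$ if it is $n$-stable with respect to $G$ for every $n\in\mathbb{N}$. *)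

(* Defs.v *)
From Stdlib Require Import Reals Lra.
From Coquelicot Require Import Coquelicot.
Open Scope R_scope.

Definition in_disk (z : C) : Prop := Cmod z < 1.

(* Functions on the disk are total functions C -> C of which only the values
   on the disk matter. *)
Definition analytic_on_disk (f : C -> C) : Prop :=
  forall z : C, in_disk z -> ex_derive (K := C_AbsRing) (V := C_NormedModule) f z.

Definition class_A1 (f : C -> C) : Prop :=
  analytic_on_disk f /\ f (RtoC 0) = RtoC 1.

Definition Cexp (z : C) : C :=
  (exp (Re z) * cos (Im z), exp (Re z) * sin (Im z)).

(* Principal argument, with values in (-PI, PI]. *)
Definition Carg (z : C) : R :=
  if Rle_dec 0 (Im z) then acos (Re z / Cmod z) else - acos (Re z / Cmod z).

Definition Clog (z : C) : C := (ln (Cmod z), Carg z).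

(* Principal power with real exponent; the value at w = 0 is irrelevant. *)
Definition Cpowr (w : C) (l : R) : C := Cexp (RtoC l * Clog w)%C.

Definition subordinate (f g : C -> C) : Prop :=
  analytic_on_disk f /\ analytic_on_disk g /\
  exists w : C -> C,
    analytic_on_disk w /\
    w (RtoC 0) = RtoC 0 /\
    (forall z : C, in_disk z -> Cmod (w z) < 1) /\
    (forall z : C, in_disk z -> f z = g (w z)).

Definition power_series_on_disk (f : C -> C) (a : nat -> C) : Prop :=
  forall z : C, in_disk z ->
    is_pseries (K := C_AbsRing) (V := C_NormedModule) a z (f z).

(* sum_n f n has the n + 1 terms f 0, ..., f n. *)
Definition partial_sum (a : nat -> C) (n : nat) (z : C) : C :=
  sum_n (fun k : nat => (a k * Cpow z k)%C) n.

(* The expansion a of F is unique, so "exists a" picks the coefficients of F;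
   it also asserts that the expansion on the whole disk exists. *)
Definition n_stable (n : nat) (F G : C -> C) : Prop :=
  class_A1 F /\ class_A1 G /\
  exists a : nat -> C,
    power_series_on_disk F a /\
    subordinate (fun z : C => partial_sum a n z / F z)%C
                (fun z : C => 1 / G z)%C.

Definition stable (F G : C -> C) : Prop :=
  forall n : nat, (1 <= n)%nat -> n_stable n F G.

Definition v (l A B : R) (z : C) : C :=
  Cpowr ((1 + RtoC A * z) / (1 + RtoC B * z))%C l.

(* Main.v *)
Require Import Defs.
From Stdlib Require Import Reals Lra.
From Coquelicot Require Import Coquelicot.
Open Scope R_scope.
Set Bullet Behavior "Strict Subproofs".

(* Put a = -A, b = -B, so 0 <= a < b <= 1, and let c_k be the coefficients of
   v = ((1 - a z) / (1 - b z))^l and s_n its partial sums. The first-order linear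
   differential equation of v gives a recurrence for the c_k which shows that they
   are nonnegative and decreasing; hence (1 - z) s_n lies in the right half-plane
   (Enestrom-Kakeya), s_n has no zero, and h = (s_n / v)^(1/l), with h(0) = 1, is
   analytic in the disk. The same recurrence yields
     h' = - (1/l) s_n^(1/l - 1) z^n (e / (1 - a z)^2 + d / (1 - a z)), with d, e >= 0,
   so |h'(z)| <= - h'(|z|) because s_n has nonnegative coefficients and 1/l >= 1.
   Integrating along the ray, |h(z) - 1| <= 1 - h(|z|) < b, and w = (1 - h) / b
   realizes the subordination s_n / v = (1 - b w)^l. That the c_k are the Taylor
   coefficients of v follows from s_n / v -> 1, since (s_n / v)' has order n z^n. *)

(** * Complex derivatives and the mean value inequality *)

Definition cderiv (f : C -> C) (z l : C) : Prop :=
  is_derive (K := C_AbsRing) (V := C_NormedModule) f z l.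

(** The product, composition and identity rules are stated for the normed module built from the ring
    [C_AbsRing], the analyticity predicate for [C_NormedModule]. The remainder estimates are
    convertible, so only the linearity half has to be given again. *)
Lemma cderiv_AbsRing (f : C -> C) (z l : C) :
  cderiv f z l <->
  is_derive (K := C_AbsRing) (V := AbsRing_NormedModule C_AbsRing) f z l.
Proof.
  split; intros [_ H]; (split; [apply is_linear_scal_l | exact H]).
Qed.

Lemma cderiv_eps (f : C -> C) (z l : C) :
  (forall eps : posreal, exists d : posreal, forall y : C, Cmod (y - z) < d ->
     Cmod (f y - f z - (y - z) * l) <= eps * Cmod (y - z)) -> cderiv f z l.
Proof.
  intros H. split; [apply is_linear_scal_l |].
  intros x Hx eps.
  (* The estimate is demanded at every limit [x] of the neighbourhood filter of [z]; uniqueness of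
     limits leaves only [z]. *)
  apply (is_filter_lim_locally_unique (K:=C_AbsRing) (V:=AbsRing_NormedModule C_AbsRing)) in Hx. subst x.
  destruct (H eps) as [d Hd]. exists d. intros y Hy. apply (Hd y). exact Hy.
Qed.

Lemma cderiv_mult (f g : C -> C) (z df dg : C) :
  cderiv f z df -> cderiv g z dg ->
  cderiv (fun x => f x * g x)%C z (df * g z + f z * dg)%C.
Proof.
  intros Hf Hg. apply cderiv_AbsRing in Hf, Hg. apply cderiv_AbsRing.
  exact (is_derive_mult (K:=C_AbsRing) f g z df dg Hf Hg Cmult_comm).
Qed.

Lemma cderiv_comp (f g : C -> C) (z df dg : C) :
  cderiv f (g z) df -> cderiv g z dg ->
  cderiv (fun x => f (g x)) z (dg * df)%C.
Proof.
  intros Hf Hg. apply cderiv_AbsRing in Hg.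
  exact (is_derive_comp (K:=C_AbsRing) (V:=C_NormedModule) f g z df dg Hf Hg).
Qed.

Lemma cderiv_plus (f g : C -> C) (z df dg : C) :
  cderiv f z df -> cderiv g z dg ->
  cderiv (fun x => f x + g x)%C z (df + dg)%C.
Proof.
  exact (is_derive_plus (K:=C_AbsRing) (V:=C_NormedModule) f g z df dg).
Qed.

Lemma cderiv_minus (f g : C -> C) (z df dg : C) :
  cderiv f z df -> cderiv g z dg ->
  cderiv (fun x => f x - g x)%C z (df - dg)%C.
Proof.
  exact (is_derive_minus (K:=C_AbsRing) (V:=C_NormedModule) f g z df dg).
Qed.

Lemma cderiv_const (c z : C) : cderiv (fun _ => c) z (RtoC 0).
Proof.
  exact (is_derive_const (K:=C_AbsRing) (V:=C_NormedModule) c z).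
Qed.

Lemma cderiv_id (z : C) : cderiv (fun x => x) z (RtoC 1).
Proof.
  apply cderiv_AbsRing. exact (is_derive_id (K:=C_AbsRing) z).
Qed.

Lemma cderiv_eq (f : C -> C) (z l l' : C) : cderiv f z l -> l = l' -> cderiv f z l'.
Proof. now intros H <-. Qed.

Lemma cderiv_scal (c : C) (f : C -> C) (z df : C) :
  cderiv f z df -> cderiv (fun x => c * f x)%C z (c * df)%C.
Proof.
  intros H. replace (c * df)%C with (RtoC 0 * f z + c * df)%C by ring.
  apply (cderiv_mult (fun _ => c) f); [apply cderiv_const | exact H].
Qed.

Lemma cderiv_ext_disk (f g : C -> C) (z l : C) :
  (forall x, in_disk x -> f x = g x) -> in_disk z -> cderiv f z l -> cderiv g z l.
Proof.
  intros E Hz. apply is_derive_ext_loc.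
  assert (Hp : 0 < 1 - Cmod z) by (unfold in_disk in Hz; lra).
  exists (mkposreal _ Hp). intros y Hy. apply E. unfold in_disk.
  change (Cmod (y - z) < 1 - Cmod z) in Hy.
  replace y with ((y - z) + z)%C by ring.
  apply Rle_lt_trans with (1 := Cmod_triangle _ _). lra.
Qed.

(** The remainders of the real and imaginary parts are the parts of the complex remainder, hence
    bounded by its modulus. This turns complex derivatives into derivatives of plane curves. *)
Lemma cderiv_real_line (f : C -> C) (t : R) (l : C) :
  cderiv f (RtoC t) l ->
  is_derive (fun t : R => Re (f (RtoC t))) t (Re l) /\
  is_derive (fun t : R => Im (f (RtoC t))) t (Im l).
Proof.
  intros [_ H].
  assert (D : forall eps : posreal, exists d : posreal, forall y : R, Rabs (y - t) < d ->
    Cmod (f (RtoC y) - f (RtoC t) - (RtoC (y - t)) * l)%C <= eps * Rabs (y - t)).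
  { intros eps. destruct (H (RtoC t) (fun P HP => HP) eps) as [d Hd].
    exists d. intros y Hy. specialize (Hd (RtoC y)).
    rewrite <- Cmod_R in Hy |- *. rewrite RtoC_minus in Hy |- *. exact (Hd Hy). }
  split; (split; [apply is_linear_scal_l |]);
  intros x Hx eps; apply (is_filter_lim_locally_unique (K:=R_AbsRing) (V:=R_NormedModule)) in Hx; subst x;
  destruct (D eps) as [d Hd]; exists d; intros y Hy;
  apply Rle_trans with (2 := Hd y Hy);
  eapply Rle_trans; [| apply Rmax_Cmod | | apply Rmax_Cmod].
  - eapply Rle_trans; [| apply Rmax_l].
    apply Req_le. simpl. unfold norm, minus, plus, opp, scal, mult; simpl.
    unfold abs, mult; simpl. f_equal. unfold Re. ring.
  - eapply Rle_trans; [| apply Rmax_r].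
    apply Req_le. simpl. unfold norm, minus, plus, opp, scal, mult; simpl.
    unfold abs, mult; simpl. f_equal. unfold Im. ring.
Qed.

Lemma derive_nonneg_le (f df : R -> R) :
  (forall t, 0 <= t <= 1 -> is_derive f t (df t)) ->
  (forall t, 0 <= t <= 1 -> 0 <= df t) -> f 0 <= f 1.
Proof.
  intros H Hp.
  destruct (MVT_gen f 0 1 df) as [c [Hc E]].
  - intros x Hx. apply H. rewrite Rmin_left, Rmax_right in Hx; lra.
  - intros x Hx. rewrite Rmin_left, Rmax_right in Hx by lra.
    apply derivable_continuous_pt. exists (df x). apply is_derive_Reals, H. lra.
  - rewrite Rmin_left, Rmax_right in Hc by lra. specialize (Hp c Hc). lra.
Qed.

(* Project the curve on the direction of its chord. *)
Lemma curve_mean_value (x y dx dy g dg : R -> R) :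
  (forall t, 0 <= t <= 1 -> is_derive x t (dx t)) ->
  (forall t, 0 <= t <= 1 -> is_derive y t (dy t)) ->
  (forall t, 0 <= t <= 1 -> is_derive g t (dg t)) ->
  (forall t, 0 <= t <= 1 -> Cmod (dx t, dy t) <= dg t) ->
  Cmod (x 1 - x 0, y 1 - y 0) <= g 1 - g 0.
Proof.
  intros Hx Hy Hg Hb.
  set (p := x 1 - x 0). set (q := y 1 - y 0). set (m := Cmod (p, q)).
  assert (Hg1 : g 0 <= g 1).
  { apply derive_nonneg_le with dg; auto. intros t Ht.
    apply Rle_trans with (2 := Hb t Ht). apply Cmod_ge_0. }
  assert (Hm : m * m = p * p + q * q).
  { unfold m, Cmod; simpl. rewrite sqrt_sqrt; [ring | nra]. }
  assert (Hm0 : 0 <= m) by apply Cmod_ge_0.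
  (* By Cauchy-Schwarz, [p dx + q dy] is at most [m] times the speed, so [m g - p x - q y] is
     nondecreasing. Its values at 0 and 1 give [m * m <= m * (g 1 - g 0)], and [m] is cancelled
     unless it is 0. *)
  assert (HM : m * g 0 - p * x 0 - q * y 0 <= m * g 1 - p * x 1 - q * y 1).
  { apply (derive_nonneg_le (fun t => m * g t - p * x t - q * y t)
      (fun t => m * dg t - p * dx t - q * dy t)).
    - intros t Ht. auto_derive.
      + repeat split; eexists; eauto.
      + rewrite (is_derive_unique (fun s : R => x s) t _ (Hx t Ht)),
          (is_derive_unique (fun s : R => y s) t _ (Hy t Ht)),
          (is_derive_unique (fun s : R => g s) t _ (Hg t Ht)). ring.
    - intros t Ht. specialize (Hb t Ht).
      set (k := Cmod (dx t, dy t)) in *.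
      assert (Hk : k * k = dx t * dx t + dy t * dy t).
      { unfold k, Cmod; simpl. rewrite sqrt_sqrt; [ring | nra]. }
      assert (Hk0 : 0 <= k) by apply Cmod_ge_0.
      assert (p * dx t + q * dy t <= m * k).
      { apply Rsqr_incr_0_var; [unfold Rsqr | nra].
        replace (m * k * (m * k)) with ((m * m) * (k * k)) by ring.
        rewrite Hm, Hk. generalize (Rle_0_sqr (p * dy t - q * dx t)); unfold Rsqr; lra. }
      nra. }
  destruct (Req_dec m 0) as [E | E]; [lra |].
  apply Rmult_le_reg_l with m; [lra |]. rewrite Hm. unfold p, q in *. lra.
Qed.

(** [curve_mean_value] for the curve t -> f(t z). The free majorant [g] allows both constant bounds
    and the comparison of f with a function on the positive axis. *)
Lemma ray_mean_value (f df : C -> C) (z : C) (g dg : R -> R) :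
  (forall t, 0 <= t <= 1 -> cderiv f (RtoC t * z)%C (df (RtoC t * z)%C)) ->
  (forall t, 0 <= t <= 1 -> is_derive g t (dg t)) ->
  (forall t, 0 <= t <= 1 -> Cmod (z * df (RtoC t * z)%C) <= dg t) ->
  Cmod (f z - f (RtoC 0)) <= g 1 - g 0.
Proof.
  intros Hf Hg Hb.
  set (F := fun w : C => f (w * z)%C).
  assert (HF : forall t, 0 <= t <= 1 -> cderiv F (RtoC t) (z * df (RtoC t * z)%C)%C).
  { intros t Ht. apply (cderiv_comp f (fun w => w * z)%C).
    - apply Hf, Ht.
    - apply cderiv_eq with (RtoC 1 * z + RtoC t * RtoC 0)%C; [| ring].
      apply (cderiv_mult (fun w => w) (fun _ => z)); [apply cderiv_id | apply cderiv_const]. }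
  assert (E : (f z - f (RtoC 0))%C =
    (Re (F (RtoC 1)) - Re (F (RtoC 0)), Im (F (RtoC 1)) - Im (F (RtoC 0)))).
  { unfold F. rewrite Cmult_1_l, Cmult_0_l. reflexivity. }
  rewrite E.
  apply (curve_mean_value (fun t => Re (F (RtoC t))) (fun t => Im (F (RtoC t)))
    (fun t => Re (z * df (RtoC t * z)%C)) (fun t => Im (z * df (RtoC t * z)%C)) g dg); auto.
  - intros t Ht. apply (cderiv_real_line F), HF, Ht.
  - intros t Ht. apply (cderiv_real_line F), HF, Ht.
Qed.

Lemma in_disk_ray (z : C) (t : R) : 0 <= t <= 1 -> in_disk z -> in_disk (RtoC t * z).
Proof.
  unfold in_disk. intros Ht Hz. rewrite Cmod_mult, Cmod_R, Rabs_pos_eq by lra.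
  generalize (Cmod_ge_0 z). nra.
Qed.

(** The difference has zero derivative along each ray from 0. This is the tool for identifying
    branches of the logarithm. *)
Lemma disk_eq_of_cderiv_eq (f g df : C -> C) :
  (forall z, in_disk z -> cderiv f z (df z)) ->
  (forall z, in_disk z -> cderiv g z (df z)) ->
  f (RtoC 0) = g (RtoC 0) -> forall z, in_disk z -> f z = g z.
Proof.
  intros Hf Hg E z Hz.
  assert (H : Cmod ((f z - g z) - (f (RtoC 0) - g (RtoC 0))) <= 0 - 0).
  { apply (ray_mean_value (fun w => f w - g w)%C (fun w => df w - df w)%C z (fun _ => 0) (fun _ => 0)).
    - intros t Ht. apply cderiv_minus; [apply Hf | apply Hg]; now apply in_disk_ray.
    - intros t _. apply is_derive_Reals, derivable_pt_lim_const.
    - intros t _. apply Req_le. rewrite <- Cmod_0. f_equal. ring. }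
  rewrite E in H. apply Ceq_minus. apply Cmod_eq_0.
  apply Rle_antisym; [| apply Cmod_ge_0].
  replace (f z - g z)%C with (f z - g z - (g (RtoC 0) - g (RtoC 0)))%C by ring. lra.
Qed.

(** * Exponential and principal logarithm *)

Lemma exp_le (x y : R) : x <= y -> exp x <= exp y.
Proof. intros [H | ->]; [left; now apply exp_increasing | right; reflexivity]. Qed.

Lemma Cexp_plus (z w : C) : Cexp (z + w) = (Cexp z * Cexp w)%C.
Proof.
  unfold Cexp; destruct z as [p q], w as [p' q']; simpl.
  rewrite exp_plus, cos_plus, sin_plus. apply injective_projections; simpl; ring.
Qed.

Lemma Cexp_RtoC (x : R) : Cexp (RtoC x) = RtoC (exp x).
Proof.
  unfold Cexp; simpl. rewrite cos_0, sin_0.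
  apply injective_projections; simpl; ring.
Qed.

Lemma Cmod_Cexp (z : C) : Cmod (Cexp z) = exp (Re z).
Proof.
  unfold Cmod, Cexp; simpl.
  replace (_ + _) with (exp (Re z) * exp (Re z) * (Rsqr (sin (Im z)) + Rsqr (cos (Im z))))
    by (unfold Rsqr; ring).
  rewrite sin2_cos2, Rmult_1_r. apply sqrt_square, Rlt_le, exp_pos.
Qed.

Lemma Cexp_neq_0 (z : C) : Cexp z <> RtoC 0.
Proof. apply Cmod_gt_0. rewrite Cmod_Cexp. apply exp_pos. Qed.

Lemma Cexp_opp (z : C) : Cexp (- z) = (/ Cexp z)%C.
Proof.
  assert (E : (Cexp z * Cexp (- z))%C = RtoC 1).
  { rewrite <- Cexp_plus. replace (z + - z)%C with (RtoC 0) by ring.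
    now rewrite Cexp_RtoC, exp_0. }
  replace (Cexp (- z)) with (/ Cexp z * (Cexp z * Cexp (- z)))%C.
  - rewrite E. ring.
  - field. apply Cexp_neq_0.
Qed.

Lemma Cexp_minus (z w : C) : Cexp (z - w) = (Cexp z / Cexp w)%C.
Proof. unfold Cminus. now rewrite Cexp_plus, Cexp_opp. Qed.

Lemma Cexp_sub_1_le (h : C) : Cmod (Cexp h - RtoC 1) <= Cmod h * exp (Cmod h).
Proof.
  destruct h as [p q]. set (K := Cmod (p, q) * exp (Cmod (p, q))).
  assert (H : Cmod (exp (1 * p) * cos (1 * q) - exp (0 * p) * cos (0 * q),
                    exp (1 * p) * sin (1 * q) - exp (0 * p) * sin (0 * q)) <= 1 * K - 0 * K).
  { apply (curve_mean_value (fun t => exp (t * p) * cos (t * q)) (fun t => exp (t * p) * sin (t * q))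
     (fun t => Re ((p, q) * Cexp (RtoC t * (p, q)))%C)
     (fun t => Im ((p, q) * Cexp (RtoC t * (p, q)))%C) (fun t => t * K) (fun _ => K)).
    - intros t Ht. auto_derive; [easy |]. unfold Cexp; simpl.
      replace (t * p - 0 * q) with (t * p) by ring. replace (t * q + 0 * p) with (t * q) by ring. ring.
    - intros t Ht. auto_derive; [easy |]. unfold Cexp; simpl.
      replace (t * p - 0 * q) with (t * p) by ring. replace (t * q + 0 * p) with (t * q) by ring. ring.
    - intros t Ht. auto_derive; [easy | ring].
    - intros t Ht. change (Cmod ((p, q) * Cexp (RtoC t * (p, q))) <= K).
      rewrite Cmod_mult, Cmod_Cexp. apply Rmult_le_compat_l; [apply Cmod_ge_0 |].
      apply exp_le. rewrite re_scal_l.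
      generalize (re_le_Cmod (p, q)) (Rle_abs (Re (p, q))) (Cmod_ge_0 (p,q)). nra. }
  replace (Cexp (p, q) - RtoC 1)%C with (exp (1 * p) * cos (1 * q) - exp (0 * p) * cos (0 * q),
                    exp (1 * p) * sin (1 * q) - exp (0 * p) * sin (0 * q)); [lra |].
  unfold Cexp; apply injective_projections; simpl; rewrite !Rmult_0_l, !Rmult_1_l, exp_0, ?cos_0, ?sin_0; ring.
Qed.

(** The curve exp(t h) - t h has velocity h (exp(t h) - 1), which [Cexp_sub_1_le] bounds; the mean
    value inequality then gives a second-order remainder. *)
Lemma Cexp_sub_1_sub_id_le (h : C) :
  Cmod (Cexp h - RtoC 1 - h) <= Cmod h * (Cmod h * exp (Cmod h)).
Proof.
  destruct h as [p q]. set (K := Cmod (p, q) * (Cmod (p, q) * exp (Cmod (p, q)))).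
  assert (H : Cmod ((exp (1 * p) * cos (1 * q) - 1 * p) - (exp (0 * p) * cos (0 * q) - 0 * p),
      (exp (1 * p) * sin (1 * q) - 1 * q) - (exp (0 * p) * sin (0 * q) - 0 * q)) <= 1 * K - 0 * K).
  { apply (curve_mean_value (fun t => exp (t * p) * cos (t * q) - t * p)
     (fun t => exp (t * p) * sin (t * q) - t * q)
     (fun t => Re ((p, q) * (Cexp (RtoC t * (p, q)) - RtoC 1))%C)
     (fun t => Im ((p, q) * (Cexp (RtoC t * (p, q)) - RtoC 1))%C) (fun t => t * K) (fun _ => K)).
    - intros t Ht. auto_derive; [easy |]. unfold Cexp; simpl.
      replace (t * p - 0 * q) with (t * p) by ring. replace (t * q + 0 * p) with (t * q) by ring. ring.
    - intros t Ht. auto_derive; [easy |]. unfold Cexp; simpl.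
      replace (t * p - 0 * q) with (t * p) by ring. replace (t * q + 0 * p) with (t * q) by ring. ring.
    - intros t Ht. auto_derive; [easy | ring].
    - intros t Ht. change (Cmod ((p, q) * (Cexp (RtoC t * (p, q)) - RtoC 1)) <= K).
      rewrite Cmod_mult. apply Rmult_le_compat_l; [apply Cmod_ge_0 |].
      apply Rle_trans with (1 := Cexp_sub_1_le _).
      rewrite Cmod_mult, Cmod_R, Rabs_pos_eq by lra.
      assert (t * Cmod (p, q) <= Cmod (p, q)) by (generalize (Cmod_ge_0 (p, q)); nra).
      apply Rmult_le_compat; [| apply Rlt_le, exp_pos | lra | now apply exp_le].
      apply Rmult_le_pos; [lra | apply Cmod_ge_0]. }
  replace (Cexp (p, q) - RtoC 1 - (p, q))%C with
   ((exp (1 * p) * cos (1 * q) - 1 * p) - (exp (0 * p) * cos (0 * q) - 0 * p),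
      (exp (1 * p) * sin (1 * q) - 1 * q) - (exp (0 * p) * sin (0 * q) - 0 * q)); [lra |].
  unfold Cexp; apply injective_projections; simpl; rewrite !Rmult_0_l, !Rmult_1_l, exp_0, ?cos_0, ?sin_0; ring.
Qed.

Lemma cderiv_Cexp (z : C) : cderiv Cexp z (Cexp z).
Proof.
  apply cderiv_eps. intros eps.
  (* For |h| < 1 the remainder is at most |exp z| e |h|^2. The added 1 keeps [M] away from 0, so
     that [eps / M] can serve as radius. *)
  set (M := Cmod (Cexp z) * exp 1 + 1).
  assert (HM : 1 <= M).
  { unfold M. generalize (Rmult_le_pos _ _ (Cmod_ge_0 (Cexp z)) (Rlt_le _ _ (exp_pos 1))). lra. }
  assert (Hd : 0 < Rmin 1 (eps / M)).
  { apply Rmin_pos; [lra | apply Rdiv_lt_0_compat; [apply cond_pos | lra]]. }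
  exists (mkposreal _ Hd). simpl. intros y Hy.
  set (h := (y - z)%C) in *.
  replace y with (z + h)%C by (unfold h; ring).
  rewrite Cexp_plus.
  replace (Cexp z * Cexp h - Cexp z - h * Cexp z)%C with (Cexp z * (Cexp h - RtoC 1 - h))%C by ring.
  rewrite Cmod_mult.
  assert (H1 : Cmod h < 1) by (apply Rlt_le_trans with (1 := Hy), Rmin_l).
  assert (H2 : M * Cmod h <= eps).
  { apply Rle_trans with (M * (eps / M)).
    - apply Rmult_le_compat_l; [lra |]. apply Rlt_le, Rlt_le_trans with (1 := Hy), Rmin_r.
    - apply Req_le. field. lra. }
  generalize (Cexp_sub_1_sub_id_le h) (Cmod_ge_0 h) (Cmod_ge_0 (Cexp z)). intros H3 H4 H5.
  assert (H6 : exp (Cmod h) <= exp 1) by (apply exp_le; lra).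
  apply Rle_trans with (Cmod (Cexp z) * (Cmod h * (Cmod h * exp 1))).
  - apply Rmult_le_compat_l; [lra |]. apply Rle_trans with (1 := H3).
    apply Rmult_le_compat_l; [lra |]. apply Rmult_le_compat_l; lra.
  - apply Rle_trans with ((M * Cmod h) * Cmod h); [unfold M; nra |].
    apply Rmult_le_compat_r; lra.
Qed.

Lemma Cmod_eq_mult_sqrt (u : C) : 0 < Re u ->
  Cmod u = Re u * sqrt (1 + (Im u / Re u)²).
Proof.
  intros H. unfold Cmod. fold (Re u) (Im u).
  rewrite <- (sqrt_square (Re u)) at 2 by lra. rewrite <- sqrt_mult_alt by nra.
  f_equal. unfold Rsqr. field. lra.
Qed.

(** Both branches of the [acos] definition become one arctangent, by oddness of [atan]; this form
    can be differentiated across the real axis. *)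
Lemma Carg_right_half_plane (u : C) : 0 < Re u -> Carg u = atan (Im u / Re u).
Proof.
  intros H. assert (Hm : 0 < Cmod u) by (apply Cmod_gt_0; intros ->; simpl in H; lra).
  assert (E : acos (Re u / Cmod u) = atan (Rabs (Im u) / Re u)).
  { rewrite acos_atan by now apply Rdiv_lt_0_compat. f_equal.
    assert (E : 1 - (Re u / Cmod u)² = (Rabs (Im u) / Cmod u)²).
    { rewrite !Rsqr_div', <- Rsqr_abs.
      assert (Cmod u * Cmod u = Re u * Re u + Im u * Im u).
      { unfold Cmod. rewrite sqrt_sqrt; unfold Re, Im; simpl; nra. }
      unfold Rsqr. field_simplify_eq; [| lra]. simpl. lra. }
    rewrite E, sqrt_Rsqr.
    - field. lra.
    - apply Rmult_le_pos; [apply Rabs_pos | apply Rlt_le, Rinv_0_lt_compat, Hm]. }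
  unfold Carg. destruct (Rle_dec 0 (Im u)) as [L | L]; rewrite E.
  - now rewrite Rabs_pos_eq.
  - rewrite Rabs_left by lra. rewrite <- atan_opp. f_equal. field. lra.
Qed.

Lemma Cexp_Clog (u : C) : 0 < Re u -> Cexp (Clog u) = u.
Proof.
  intros H. assert (Hm : 0 < Cmod u) by (apply Cmod_gt_0; intros ->; simpl in H; lra).
  unfold Cexp, Clog; simpl. rewrite exp_ln by assumption.
  rewrite Carg_right_half_plane by assumption.
  rewrite cos_atan, sin_atan, Cmod_eq_mult_sqrt by assumption.
  assert (0 < sqrt (1 + (Im u / Re u)²)) by (apply sqrt_lt_R0; generalize (Rle_0_sqr (Im u / Re u)); lra).
  apply injective_projections; simpl.
  - unfold Re. field. unfold Re in *; lra.
  - unfold Im, Re in *. field. lra.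
Qed.

Lemma Clog_pos (x : R) : 0 < x -> Clog (RtoC x) = RtoC (ln x).
Proof.
  intros H. unfold Clog. rewrite Carg_right_half_plane by assumption.
  rewrite Cmod_R, Rabs_pos_eq by lra. simpl. unfold Rdiv. now rewrite Rmult_0_l, atan_0.
Qed.

Lemma ln_sqrt (x : R) : 0 < x -> ln (sqrt x) = / 2 * ln x.
Proof.
  intros H. rewrite <- (sqrt_sqrt x) at 2 by lra.
  rewrite ln_mult by now apply sqrt_lt_R0. field.
Qed.

Lemma pow2_eq (x : R) : x ^ 2 = x * x.
Proof. ring. Qed.

(** Mean value inequality on the segment from u to u + h for the logarithm minus its linear part:
    the velocity is h (1 / (u + t h) - 1 / u) = - t h^2 / (u (u + t h)), of second order in h. *)
Lemma cderiv_Clog (u : C) : 0 < Re u -> cderiv Clog u (/ u)%C.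
Proof.
  intros Hu. apply cderiv_eps. intros eps.
  assert (Hu0 : u <> RtoC 0) by (intros ->; simpl in Hu; lra).
  assert (Hm : 0 < Cmod u) by now apply Cmod_gt_0.
  assert (HRm : Re u <= Cmod u) by (generalize (re_le_Cmod u) (Rle_abs (Re u)); lra).
  (* The first bound keeps the segment in the right half-plane and |u + t h| above |u| / 2; the
     second makes 2 |h|^2 / |u|^2 at most eps |h|. *)
  assert (Hd : 0 < Rmin (Re u / 2) (eps * (Cmod u * Cmod u) / 2)).
  { apply Rmin_pos; [lra |].
    generalize (Rmult_lt_0_compat _ _ (cond_pos eps) (Rmult_lt_0_compat _ _ Hm Hm)). lra. }
  exists (mkposreal _ Hd). simpl. intros y Hy.
  assert (H1 : Cmod (y - u) < Re u / 2) by (apply Rlt_le_trans with (1 := Hy), Rmin_l).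
  assert (H2 : Cmod (y - u) < eps * (Cmod u * Cmod u) / 2) by (apply Rlt_le_trans with (1 := Hy), Rmin_r).
  set (h := (y - u)%C) in *.
  assert (Ey : y = (u + h)%C) by (unfold h; ring).
  clearbody h.
  assert (Hh : - (Re u / 2) < Re h) by (generalize (re_le_Cmod h) (Rabs_maj2 (Re h)); lra).
  assert (Hpos : forall t, 0 <= t <= 1 -> 0 < Re u + t * Re h) by (intros t Ht; nra).
  assert (Hsq : forall t, 0 <= t <= 1 ->
    0 < (Re u + t * Re h) * (Re u + t * Re h) + (Im u + t * Im h) * (Im u + t * Im h)).
  { intros t Ht. specialize (Hpos t Ht).
    generalize (Rmult_lt_0_compat _ _ Hpos Hpos) (Rle_0_sqr (Im u + t * Im h)). unfold Rsqr. lra. }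
  assert (ERe : forall c d, Re (h * (c - d))%C = Re (h * c)%C - Re (h * d)%C).
  { intros c d. unfold Re; simpl. ring. }
  assert (EIm : forall c d, Im (h * (c - d))%C = Im (h * c)%C - Im (h * d)%C).
  { intros c d. unfold Im; simpl. ring. }
  assert (HReq : forall t, Re (u + RtoC t * h)%C = Re u + t * Re h).
  { intros t. unfold Re, Im; simpl. ring. }
  assert (HImq : forall t, Im (u + RtoC t * h)%C = Im u + t * Im h).
  { intros t. unfold Re, Im; simpl. ring. }
  assert (Hne : forall t, 0 <= t <= 1 -> (u + RtoC t * h)%C <> RtoC 0).
  { intros t Ht E. specialize (Hpos t Ht). rewrite <- HReq, E in Hpos. simpl in Hpos. lra. }
  set (K := 2 * (Cmod h * Cmod h) / (Cmod u * Cmod u)).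
  assert (B : Cmod (Clog y - Clog u - h * / u) <= K).
  { set (X := fun t => / 2 * ln ((Re u + t * Re h) * (Re u + t * Re h) +
        (Im u + t * Im h) * (Im u + t * Im h)) - t * Re (h / u)%C).
    set (Y := fun t => atan ((Im u + t * Im h) / (Re u + t * Re h)) - t * Im (h / u)%C).
    assert (EX : forall t, 0 <= t <= 1 -> (Clog (u + RtoC t * h) - RtoC t * (h / u))%C = (X t, Y t)).
    { intros t Ht.
      unfold Clog. rewrite Carg_right_half_plane by (rewrite HReq; now apply Hpos).
      rewrite HReq, HImq.
      assert (EL : ln (Cmod (u + RtoC t * h)) = / 2 * ln ((Re u + t * Re h) * (Re u + t * Re h) +
        (Im u + t * Im h) * (Im u + t * Im h))).
      { unfold Cmod. fold (Re (u + RtoC t * h)%C) (Im (u + RtoC t * h)%C).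
        rewrite HReq, HImq, ln_sqrt by (rewrite !pow2_eq; now apply Hsq).
        rewrite !pow2_eq. field. }
      rewrite EL. unfold X, Y. generalize (h / u)%C. intros c.
      apply injective_projections; unfold Re, Im; simpl; ring. }
    replace (Clog y - Clog u - h * / u)%C with (X 1 - X 0, Y 1 - Y 0).
    - replace K with (1 * K - 0 * K) by ring.
      apply (curve_mean_value X Y (fun t => Re (h * (/ (u + RtoC t * h) - / u))%C)
        (fun t => Im (h * (/ (u + RtoC t * h) - / u))%C) (fun t => t * K) (fun _ => K)).
      + intros t Ht. unfold X. rewrite ERe. change (h * / u)%C with (h / u)%C.
        specialize (Hsq t Ht). generalize (Re (h / u)%C); intros c.
        auto_derive; [assumption |].
        unfold Re, Im in *. simpl. field. simpl in Hsq. lra.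
      + intros t Ht. unfold Y. rewrite EIm. change (h * / u)%C with (h / u)%C.
        specialize (Hsq t Ht). specialize (Hpos t Ht). generalize (Im (h / u)%C); intros c.
        auto_derive; [lra |].
        unfold Re, Im in *. simpl. field. simpl in Hsq, Hpos. lra.
      + intros t Ht. auto_derive; [easy | ring].
      + intros t Ht. change (Cmod (h * (/ (u + RtoC t * h) - / u)) <= K).
        replace (h * (/ (u + RtoC t * h) - / u))%C with
          (- (RtoC t * (h * h) / (u * (u + RtoC t * h))))%C by (field; auto).
        rewrite Cmod_opp, Cmod_div by (apply Cmult_neq_0; auto).
        rewrite !Cmod_mult, Cmod_R, Rabs_pos_eq by lra.
        assert (L : Cmod u / 2 <= Cmod (u + RtoC t * h)).
        { assert (Cmod u <= Cmod (u + RtoC t * h) + Cmod (- (RtoC t * h))).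
          { eapply Rle_trans; [| apply Cmod_triangle]. apply Req_le; f_equal; ring. }
          rewrite Cmod_opp, Cmod_mult, Cmod_R, Rabs_pos_eq in H by lra.
          generalize (Cmod_ge_0 h). nra. }
        apply Rle_trans with (1 * (Cmod h * Cmod h) / (Cmod u * (Cmod u / 2))).
        * unfold Rdiv at 1 2. apply Rmult_le_compat.
          -- generalize (Cmod_ge_0 h); nra.
          -- apply Rlt_le, Rinv_0_lt_compat. apply Rmult_lt_0_compat; lra.
          -- apply Rmult_le_compat_r; [generalize (Cmod_ge_0 h); nra | lra].
          -- apply Rinv_le_contravar; [apply Rmult_lt_0_compat; lra |].
             apply Rmult_le_compat_l; lra.
        * unfold K. apply Req_le. field. lra.
    - assert (E : (Clog y - Clog u - h * / u)%C = ((X 1, Y 1) - (X 0, Y 0))%C).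
      { rewrite <- !EX by lra. rewrite Ey, Cmult_0_l, !Cmult_1_l, Cplus_0_r. unfold Cdiv. ring. }
      rewrite E. reflexivity. }
  apply Rle_trans with (1 := B). unfold K.
  apply Rmult_le_reg_r with (Cmod u * Cmod u); [nra |].
  unfold Rdiv. rewrite Rmult_assoc, Rinv_l, Rmult_1_r by nra.
  generalize (Cmod_ge_0 h). nra.
Qed.

(** * Powers of 1 - c z in the disk *)

Definition lin (c : R) (z : C) : C := (1 - RtoC c * z)%C.

Lemma one_plus_opp (c : R) (z : C) : (1 + RtoC (- c) * z)%C = lin c z.
Proof. unfold lin. rewrite RtoC_opp. ring. Qed.

Lemma lin_0 (c : R) : lin c (RtoC 0) = RtoC 1.
Proof. unfold lin. ring. Qed.

Lemma cderiv_lin (c : R) (z : C) : cderiv (lin c) z (- RtoC c)%C.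
Proof.
  apply cderiv_eq with (RtoC 0 - RtoC c * RtoC 1)%C; [| ring].
  apply (cderiv_minus (fun _ => RtoC 1) (fun x => RtoC c * x)%C); [apply cderiv_const |].
  apply (cderiv_scal (RtoC c) (fun x => x)), cderiv_id.
Qed.

Lemma Re_Im_disk (z : C) : in_disk z -> Re z * Re z + Im z * Im z < 1.
Proof.
  unfold in_disk, Cmod. intros H. rewrite <- sqrt_1 in H. apply sqrt_lt_0_alt in H.
  unfold Re, Im. simpl in H. lra.
Qed.

Lemma Re_lin_pos (c : R) (z : C) : 0 <= c <= 1 -> in_disk z -> 0 < Re (lin c z).
Proof.
  intros Hc Hz. apply Re_Im_disk in Hz.
  assert (Hx : Re z < 1) by nra.
  replace (Re (lin c z)) with (1 - c * Re z) by (unfold lin, Re; simpl; ring).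
  destruct (Rle_lt_dec (Re z) 0); nra.
Qed.

Lemma lin_neq_0 (c : R) (z : C) : 0 <= c <= 1 -> in_disk z -> lin c z <> RtoC 0.
Proof. intros Hc Hz E. generalize (Re_lin_pos c z Hc Hz). rewrite E. simpl. lra. Qed.

(** The real part of the quotient has the sign of the inner product of 1 - a z and 1 - b z as plane
    vectors. Both real parts are positive, and the product of the imaginary parts is a b (Im
    z)^2. *)
Lemma Re_lin_div_pos (a b : R) (z : C) : 0 <= a <= 1 -> 0 <= b <= 1 -> in_disk z ->
  0 < Re (lin a z / lin b z)%C.
Proof.
  intros Ha Hb Hz. generalize (Re_lin_pos a z Ha Hz) (Re_lin_pos b z Hb Hz).
  intros Pa Pb.
  replace (Re (lin a z / lin b z)%C) with
    ((Re (lin a z) * Re (lin b z) + Im (lin a z) * Im (lin b z)) /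
     (Re (lin b z) * Re (lin b z) + Im (lin b z) * Im (lin b z))).
  - apply Rdiv_lt_0_compat; [| nra].
    assert (0 <= Im (lin a z) * Im (lin b z)); [| nra].
    replace (Im (lin a z) * Im (lin b z)) with (a * b * (Im z * Im z)).
    + apply Rmult_le_pos; nra.
    + unfold lin, Im; simpl. ring.
  - unfold Re, Im in *. simpl in *. field. nra.
Qed.

Lemma cderiv_Clog_comp (f : C -> C) (z df : C) : 0 < Re (f z) -> cderiv f z df ->
  cderiv (fun x => Clog (f x)) z (df / f z)%C.
Proof.
  intros H Hf. apply (cderiv_comp Clog f); [now apply cderiv_Clog | exact Hf].
Qed.

Lemma cderiv_Cexp_comp (f : C -> C) (z df : C) : cderiv f z df ->
  cderiv (fun x => Cexp (f x)) z (df * Cexp (f z))%C.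
Proof. intros Hf. apply (cderiv_comp Cexp f); [apply cderiv_Cexp | exact Hf]. Qed.

Lemma cderiv_Clog_lin (c : R) (z : C) : 0 <= c <= 1 -> in_disk z ->
  cderiv (fun x => Clog (lin c x)) z (- RtoC c / lin c z)%C.
Proof.
  intros Hc Hz. apply cderiv_Clog_comp; [now apply Re_lin_pos | apply cderiv_lin].
Qed.

Lemma Clog_1 : Clog (RtoC 1) = RtoC 0.
Proof. now rewrite Clog_pos, ln_1 by lra. Qed.

(** As long as exp M stays in the right half-plane, the principal logarithm of exp M has derivative
    M', and it agrees with M at 0; so no multiple of 2 pi i can appear. *)
Lemma Clog_Cexp_disk (M dM : C -> C) :
  (forall z, in_disk z -> cderiv M z (dM z)) -> M (RtoC 0) = RtoC 0 ->
  (forall z, in_disk z -> 0 < Re (Cexp (M z))) ->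
  forall z, in_disk z -> Clog (Cexp (M z)) = M z.
Proof.
  intros HM H0 Hp. apply (disk_eq_of_cderiv_eq _ _ dM); [| exact HM |].
  - intros z Hz. eapply cderiv_eq.
    + apply cderiv_Clog_comp; [now apply Hp |]. apply cderiv_Cexp_comp, HM, Hz.
    + cbv beta. field. apply Cexp_neq_0.
  - now rewrite H0, Cexp_RtoC, exp_0, Clog_1.
Qed.

(** Principal logarithms need not be additive. Here the quotient stays in the right half-plane, so
    the difference of the logarithms is the principal branch. *)
Lemma Clog_lin_div (a b : R) (z : C) : 0 <= a <= 1 -> 0 <= b <= 1 -> in_disk z ->
  Clog (lin a z / lin b z) = (Clog (lin a z) - Clog (lin b z))%C.
Proof.
  intros Ha Hb Hz.
  assert (E : forall x, in_disk x ->
    Cexp (Clog (lin a x) - Clog (lin b x)) = (lin a x / lin b x)%C).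
  { intros x Hx. now rewrite Cexp_minus, !Cexp_Clog by now apply Re_lin_pos. }
  rewrite <- E by assumption.
  apply (Clog_Cexp_disk (fun x => Clog (lin a x) - Clog (lin b x))%C
    (fun x => - RtoC a / lin a x - - RtoC b / lin b x)%C); [| | | assumption].
  - intros x Hx. apply cderiv_minus; now apply cderiv_Clog_lin.
  - rewrite !lin_0. ring.
  - intros x Hx. rewrite E by assumption. now apply Re_lin_div_pos.
Qed.

Lemma v_eq_Cexp (l a b : R) (z : C) : 0 <= a <= 1 -> 0 <= b <= 1 -> in_disk z ->
  v l (- a) (- b) z = Cexp (RtoC l * (Clog (lin a z) - Clog (lin b z))).
Proof.
  intros Ha Hb Hz. unfold v, Cpowr. rewrite <- Clog_lin_div by assumption.
  now rewrite !one_plus_opp.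
Qed.

(** * Decay of n r^n and bounds for |1 - c z| *)

(** The right side is (1 - p) times the sum of p^k for k up to n, and each of these n + 1 terms is
    at least p^n. *)
Lemma succ_mult_pow_le (p : R) (n : nat) : 0 <= p < 1 ->
  (INR n + 1) * p ^ n * (1 - p) <= 1 - p ^ S n.
Proof.
  intros Hp. induction n as [| n IH]; [simpl; lra |].
  assert (H : p ^ S n <= 1) by (rewrite <- (pow1 (S n)); apply pow_incr; lra).
  rewrite S_INR. simpl in *. nra.
Qed.

(* With r = p^2, n r^n = (n p^n) p^n, whose first factor is bounded. *)
Lemma is_lim_seq_affine_geom (r : R) : 0 <= r < 1 ->
  is_lim_seq (fun n => (1 + 2 * INR n) * r ^ n) 0.
Proof.
  intros Hr. set (p := sqrt r).
  assert (Hp : 0 <= p < 1).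
  { split; [apply sqrt_pos |]. rewrite <- sqrt_1. apply sqrt_lt_1_alt. lra. }
  (* The constant comes from (1 + 2 n) p^n <= 2 (n + 1) p^n and [succ_mult_pow_le]. *)
  apply is_lim_seq_le_le with (u := fun _ => 0) (w := fun n => 2 / (1 - p) * p ^ n).
  - intros n. assert (Hn := pos_INR n). split.
    + apply Rmult_le_pos; [lra | now apply pow_le].
    + assert (E : r ^ n = p ^ n * p ^ n).
      { rewrite <- Rpow_mult_distr. unfold p. now rewrite sqrt_sqrt by lra. }
      rewrite E, <- Rmult_assoc. apply Rmult_le_compat_r; [now apply pow_le |].
      apply Rmult_le_reg_r with (1 - p); [lra |].
      unfold Rdiv. rewrite (Rmult_assoc 2), Rinv_l by lra.
      assert (H := succ_mult_pow_le p n Hp). assert (H1 := pow_le p n (proj1 Hp)).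
      assert (H2 := pow_le p (S n) (proj1 Hp)).
      assert (H3 : 0 <= p ^ n * (1 - p)) by (apply Rmult_le_pos; lra). nra.
  - apply is_lim_seq_const.
  - replace (Finite 0) with (Rbar_mult (2 / (1 - p)) 0) by (simpl; f_equal; ring).
    apply is_lim_seq_scal_l, is_lim_seq_geom. rewrite Rabs_pos_eq; lra.
Qed.

Lemma Cmod_lin_ge (c : R) (z : C) : 0 <= c -> 1 - c * Cmod z <= Cmod (lin c z).
Proof.
  intros Hc. assert (H := Cmod_triangle (lin c z) (RtoC c * z)).
  rewrite Cmod_mult, Cmod_R, (Rabs_pos_eq c) in H by assumption.
  replace (lin c z + RtoC c * z)%C with (RtoC 1) in H by (unfold lin; ring).
  rewrite Cmod_1 in H. lra.
Qed.

Lemma Cmod_lin_le (c : R) (z : C) : 0 <= c -> Cmod (lin c z) <= 1 + c * Cmod z.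
Proof.
  intros Hc. unfold lin. eapply Rle_trans; [apply Cmod_triangle |].
  rewrite Cmod_1, Cmod_opp, Cmod_mult, Cmod_R, Rabs_pos_eq; lra.
Qed.

(** * Partial sums *)

Section PartialSums.

Context (l a b : R).

(* v = v_l(-a, -b) satisfies v' (1 - a z) (1 - b z) = l (b - a) v. The first
   components are the Taylor coefficients c_n of v, the second ones
   e_n = (n + 1) c_{n+1} - b n c_n are those of (1 - b z) v'; dividing the
   equation by 1 - a z gives e_{n+1} = a e_n + l (b - a) c_{n+1}. *)
Fixpoint coef_pair (n : nat) : R * R :=
  match n with
  | O => (1, l * (b - a))
  | S m =>
      let c := (snd (coef_pair m) + b * INR m * fst (coef_pair m)) / INR (S m) in
      (c, a * snd (coef_pair m) + l * (b - a) * c)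
  end.

Definition coef (n : nat) : R := fst (coef_pair n).
Definition coef_defect (n : nat) : R := snd (coef_pair n).

Lemma coef_S (n : nat) :
  INR (S n) * coef (S n) = coef_defect n + b * INR n * coef n.
Proof.
  unfold coef, coef_defect. cbn [coef_pair fst]. field. apply not_0_INR. discriminate.
Qed.

Lemma coef_defect_S (n : nat) :
  coef_defect (S n) = a * coef_defect n + l * (b - a) * coef (S n).
Proof. reflexivity. Qed.

Definition psum (n : nat) (z : C) : C := partial_sum (fun k => RtoC (coef k)) n z.

Fixpoint dpsum (n : nat) (z : C) : C :=
  match n with
  | O => RtoC 0
  | S m => (dpsum m z + RtoC (INR (S m) * coef (S m)) * z ^ m)%C
  end.

Lemma psum_0 (z : C) : psum 0 z = RtoC 1.
Proof. unfold psum, partial_sum. rewrite sum_O. apply Cmult_1_l. Qed.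

Lemma psum_S (n : nat) (z : C) :
  psum (S n) z = (psum n z + RtoC (coef (S n)) * z ^ S n)%C.
Proof. unfold psum, partial_sum. rewrite sum_Sn. reflexivity. Qed.

Lemma cderiv_pow_S (n : nat) (z : C) :
  cderiv (fun x => x ^ S n)%C z (RtoC (INR (S n)) * z ^ n)%C.
Proof.
  induction n as [| n IH].
  - apply cderiv_eq with (RtoC 1 * RtoC 1 + z * RtoC 0)%C; [| simpl; ring].
    apply (cderiv_mult (fun x => x) (fun _ => RtoC 1)); [apply cderiv_id | apply cderiv_const].
  - eapply cderiv_eq.
    + apply (cderiv_mult (fun x => x) (fun x => x ^ S n)%C); [apply cderiv_id | exact IH].
    + rewrite (S_INR (S n)), RtoC_plus. simpl Cpow. ring.
Qed.

Lemma cderiv_psum (n : nat) (z : C) : cderiv (psum n) z (dpsum n z).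
Proof.
  induction n as [| n IH].
  - apply (is_derive_ext (K:=C_AbsRing) (V:=C_NormedModule) (fun _ => RtoC 1)); [intros t; now rewrite psum_0 |].
    apply cderiv_const.
  - apply (is_derive_ext (K:=C_AbsRing) (V:=C_NormedModule) (fun x => psum n x + RtoC (coef (S n)) * x ^ S n)%C).
    + intros t. now rewrite psum_S.
    + cbn [dpsum]. apply (cderiv_plus (psum n)); [exact IH |].
      eapply cderiv_eq.
      * apply (cderiv_scal _ (fun x => x ^ S n)%C), cderiv_pow_S.
      * rewrite RtoC_mult. ring.
Qed.

(* The differential equation of v holds for s_n up to two terms. *)
Lemma psum_ode (n : nat) (z : C) :
  (dpsum n z * (lin a z * lin b z))%C =
  (RtoC (l * (b - a)) * psum n z -
   z ^ n * (RtoC (coef_defect n) + RtoC (b * INR n * coef n) * lin a z))%C.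
Proof.
  induction n as [| n IH].
  - rewrite psum_0. unfold coef, coef_defect, lin. simpl.
    rewrite Rmult_0_r, Rmult_0_l. ring.
  - assert (E : b * INR (S n) * coef (S n) = b * coef_defect n + b * (b * INR n * coef n))
      by (rewrite Rmult_assoc, coef_S; ring).
    cbn [dpsum]. rewrite Cmult_plus_distr_r, IH, psum_S, coef_defect_S, E, coef_S.
    rewrite !RtoC_plus, !RtoC_mult, Cpow_S. unfold lin. ring.
Qed.

(** * Monotone coefficients and absence of zeros of the partial sums *)

Context (Hl0 : 0 < l) (Hl1 : l <= 1) (Ha : 0 <= a) (Hab : a < b) (Hb : b <= 1).

(** By [coef_S], c_{m+1} is the average of one copy of e_m and m copies of b c_m, so it lies between
    e_m and b c_m once e_m <= b c_m is known. That bound is inherited: e_{m+1} = a e_m + l (b - a)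
    c_{m+1} <= a c_{m+1} + (b - a) c_{m+1} = b c_{m+1}, using l <= 1. *)
Lemma coef_bounds (n : nat) :
  0 <= coef n /\ 0 <= coef_defect n <= b * coef n /\
  (coef_defect n <= coef (S n)) /\ coef (S n) <= b * coef n.
Proof.
  assert (D : forall m, 0 <= coef m -> 0 <= coef_defect m <= b * coef m ->
     0 <= coef (S m) /\ (coef_defect m <= coef (S m)) /\ coef (S m) <= b * coef m).
  { intros m H1 H2. assert (HS : 0 < INR (S m)) by (apply lt_0_INR; auto with arith).
    assert (Hm : 0 <= INR m) by apply pos_INR.
    assert (E := coef_S m). rewrite S_INR in *.
    assert (H3 : INR m * coef_defect m <= INR m * (b * coef m)) by (apply Rmult_le_compat_l; lra).
    assert (H4 : 0 <= INR m * coef_defect m) by (apply Rmult_le_pos; lra).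
    assert (H5 : 0 <= b * INR m * coef m) by (repeat apply Rmult_le_pos; lra).
    repeat split; apply Rmult_le_reg_l with (INR m + 1); lra. }
  assert (M : 0 <= coef n /\ 0 <= coef_defect n <= b * coef n).
  { induction n as [| n [I1 I2]].
    - unfold coef, coef_defect; simpl. nra.
    - destruct (D n I1 I2) as (D1 & D2 & D3). split; [assumption |].
      rewrite coef_defect_S.
      assert (0 <= a * coef_defect n) by (apply Rmult_le_pos; lra).
      assert (a * coef_defect n <= a * coef (S n)) by (apply Rmult_le_compat_l; lra).
      assert (0 <= l * (b - a) <= b - a) by nra.
      nra. }
  destruct M as [M1 M2]. destruct (D n M1 M2) as (D1 & D2 & D3). auto.
Qed.

Lemma coef_pos (n : nat) : 0 <= coef n.
Proof. apply coef_bounds. Qed.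

Lemma coef_S_le (n : nat) : coef (S n) <= coef n.
Proof. destruct (coef_bounds n) as (H1 & _ & _ & H). nra. Qed.

Lemma coef_le_1 (n : nat) : coef n <= 1.
Proof.
  induction n as [| n IH]; [unfold coef; simpl; lra |]. generalize (coef_S_le n); lra.
Qed.

(* Enestrom-Kakeya: the coefficients decrease. *)
Lemma lin_1_psum_near_1 (n : nat) (z : C) : in_disk z ->
  Cmod (lin 1 z * psum n z - 1 + RtoC (coef n) * z ^ S n) <= Cmod z * (1 - coef n).
Proof.
  intros Hz. assert (Hm := Cmod_ge_0 z). unfold in_disk in Hz.
  induction n as [| n IH].
  - rewrite psum_0. unfold coef; simpl. apply Req_le.
    rewrite Rminus_diag, Rmult_0_r, <- Cmod_0. f_equal. unfold lin. ring.
  - rewrite psum_S.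
    (* Passing from n to n + 1 changes the expression by - (c_n - c_{n+1}) z^(n+1) only, and these
       moduli telescope to 1 - c_n. *)
    replace (lin 1 z * (psum n z + RtoC (coef (S n)) * z ^ S n) - 1 + RtoC (coef (S n)) * z ^ S (S n))%C
      with ((lin 1 z * psum n z - 1 + RtoC (coef n) * z ^ S n) - RtoC (coef n - coef (S n)) * z ^ S n)%C
      by (rewrite RtoC_minus; unfold lin; simpl; ring).
    eapply Rle_trans; [apply Cmod_triangle |]. rewrite Cmod_opp, Cmod_mult, Cmod_R, Cmod_pow.
    assert (H := coef_S_le n). rewrite Rabs_pos_eq by lra.
    assert (Hp : Cmod z ^ S n <= Cmod z).
    { simpl. assert (Cmod z ^ n <= 1) by (rewrite <- (pow1 n); apply pow_incr; lra). nra. }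
    nra.
Qed.

(** Since c_n |z|^(n+1) <= c_n |z|, removing that term from [lin_1_psum_near_1] gives |(1 - z) s_n -
    1| <= |z| < 1. *)
Lemma Re_lin_1_psum_pos (n : nat) (z : C) : in_disk z -> 0 < Re (lin 1 z * psum n z)%C.
Proof.
  intros Hz. assert (H := lin_1_psum_near_1 n z Hz). assert (Hm := Cmod_ge_0 z).
  set (q := (lin 1 z * psum n z)%C) in *.
  assert (B : Cmod (q - 1) < 1).
  { replace (q - 1)%C with ((q - 1 + RtoC (coef n) * z ^ S n) - RtoC (coef n) * z ^ S n)%C by ring.
    eapply Rle_lt_trans; [apply Cmod_triangle |]. rewrite Cmod_opp, Cmod_mult, Cmod_R, Cmod_pow.
    unfold in_disk in Hz.
    assert (Cmod z ^ n <= 1) by (rewrite <- (pow1 n); apply pow_incr; lra).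
    rewrite Rabs_pos_eq by apply coef_pos. assert (Hc := coef_pos n).
    assert (Cmod z ^ S n <= Cmod z) by (simpl; nra). nra. }
  assert (E : Re (q - 1)%C = Re q - 1) by (unfold Re; simpl; ring).
  generalize (re_le_Cmod (q - 1)) (Rabs_maj2 (Re (q - 1)%C)). rewrite E. lra.
Qed.

Lemma psum_neq_0 (n : nat) (z : C) : in_disk z -> psum n z <> RtoC 0.
Proof.
  intros Hz E. generalize (Re_lin_1_psum_pos n z Hz). rewrite E, Cmult_0_r. simpl. lra.
Qed.

(** * Comparison with the partial sums on the positive axis *)

Definition rpsum (n : nat) (r : R) : R := sum_n (fun k => coef k * r ^ k) n.

Lemma rpsum_0 (r : R) : rpsum 0 r = 1.
Proof. unfold rpsum. rewrite sum_O. apply Rmult_1_l. Qed.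

Lemma rpsum_S (n : nat) (r : R) : rpsum (S n) r = rpsum n r + coef (S n) * r ^ S n.
Proof. unfold rpsum. rewrite sum_Sn. reflexivity. Qed.

Lemma psum_RtoC (n : nat) (r : R) : psum n (RtoC r) = RtoC (rpsum n r).
Proof.
  induction n as [| n IH].
  - now rewrite psum_0, rpsum_0.
  - now rewrite psum_S, IH, rpsum_S, RtoC_plus, RtoC_mult, RtoC_pow.
Qed.

Lemma rpsum_ge_1 (n : nat) (r : R) : 0 <= r -> 1 <= rpsum n r.
Proof.
  intros Hr. induction n as [| n IH]; [rewrite rpsum_0; lra |]. rewrite rpsum_S.
  generalize (Rmult_le_pos _ _ (coef_pos (S n)) (pow_le r (S n) Hr)). lra.
Qed.

Lemma Cmod_psum_le (n : nat) (z : C) : Cmod (psum n z) <= rpsum n (Cmod z).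
Proof.
  induction n as [| n IH].
  - rewrite psum_0, rpsum_0, Cmod_1. lra.
  - rewrite psum_S, rpsum_S.
    eapply Rle_trans; [apply Cmod_triangle |]. apply Rplus_le_compat; [exact IH |].
    rewrite Cmod_mult, Cmod_R, Cmod_pow, Rabs_pos_eq; [lra | apply coef_pos].
Qed.

Lemma psum_at_0 (n : nat) : psum n (RtoC 0) = RtoC 1.
Proof.
  induction n as [| n IH]; [apply psum_0 |]. rewrite psum_S, IH, Cpow_S. ring.
Qed.

(** * The quotient s_n / v and the Taylor expansion of v *)

Lemma in_unit_a : 0 <= a <= 1. Proof. lra. Qed.
Lemma in_unit_b : 0 <= b <= 1. Proof. lra. Qed.
Lemma in_unit_1 : 0 <= 1 <= 1. Proof. lra. Qed.
Hint Resolve in_unit_a in_unit_b in_unit_1 Re_lin_pos lin_neq_0 : core.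

(** This is s_n / v, with 1 / v written as the exponential of the opposite logarithm. *)
Definition psum_div (n : nat) (z : C) : C :=
  (psum n z * Cexp (RtoC l * (Clog (lin b z) - Clog (lin a z))))%C.

Definition dpsum_div (n : nat) (z : C) : C :=
  (- (Cexp (RtoC l * (Clog (lin b z) - Clog (lin a z))) *
      (z ^ n * (RtoC (coef_defect n) + RtoC (b * INR n * coef n) * lin a z) /
       (lin a z * lin b z))))%C.

(** The logarithmic derivative of v is l (b - a) / ((1 - a z) (1 - b z)); it cancels the main term
    of [psum_ode], and only the remainder with its factor z^n survives. *)
Lemma cderiv_psum_div (n : nat) (z : C) : in_disk z ->
  cderiv (psum_div n) z (dpsum_div n z).
Proof.
  intros Hz. eapply cderiv_eq.
  - apply (cderiv_mult (psum n)); [apply cderiv_psum |].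
    apply cderiv_Cexp_comp, cderiv_scal, cderiv_minus; apply cderiv_Clog_lin; auto.
  - unfold dpsum_div. assert (Hla : lin a z <> RtoC 0) by auto. assert (Hlb : lin b z <> RtoC 0) by auto.
    assert (O : dpsum n z = ((RtoC (l * (b - a)) * psum n z -
      z ^ n * (RtoC (coef_defect n) + RtoC (b * INR n * coef n) * lin a z)) / (lin a z * lin b z))%C).
    { rewrite <- psum_ode. field. auto. }
    rewrite O, RtoC_mult, RtoC_minus. unfold lin in *. field. auto.
Qed.

(** On the ray to z, with r = |z|, the derivative is bounded factor by factor: |1 / v| by 2 / (1 -
    r), the denominator from below by (1 - r)^2, and e_n + b n c_n (1 - a w) by 1 + 2 n, since the
    coefficients are at most 1. *)
Lemma psum_div_sub_1_le (n : nat) (z : C) : in_disk z ->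
  Cmod (psum_div n z - 1) <=
  exp (ln 2 - ln (1 - Cmod z)) / ((1 - Cmod z) * (1 - Cmod z)) * ((1 + 2 * INR n) * Cmod z ^ n).
Proof.
  intros Hz. set (r := Cmod z). assert (Hr0 : 0 <= r) by apply Cmod_ge_0.
  assert (Hr1 : r < 1) by exact Hz.
  set (K := exp (ln 2 - ln (1 - r)) / ((1 - r) * (1 - r)) * ((1 + 2 * INR n) * r ^ n)).
  assert (E0 : psum_div n (RtoC 0) = RtoC 1).
  { unfold psum_div. rewrite psum_at_0, !lin_0. unfold Cminus.
    rewrite Cplus_opp_r, Cmult_0_r, Cexp_RtoC, exp_0. ring. }
  rewrite <- E0. replace K with (1 * K - 0 * K) by ring.
  apply (ray_mean_value (psum_div n) (dpsum_div n) z (fun t => t * K) (fun _ => K)).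
  - intros t Ht. apply cderiv_psum_div. now apply in_disk_ray.
  - intros t Ht. auto_derive; [easy | ring].
  - intros t Ht. unfold dpsum_div. set (w := (RtoC t * z)%C).
    assert (Hw : in_disk w) by now apply in_disk_ray.
    assert (Hwr : Cmod w <= r).
    { unfold w. rewrite Cmod_mult, Cmod_R, Rabs_pos_eq by lra. fold r. nra. }
    assert (Hw0 := Cmod_ge_0 w).
    assert (La : 1 - r <= Cmod (lin a w) <= 2).
    { generalize (Cmod_lin_ge a w Ha) (Cmod_lin_le a w Ha). nra. }
    assert (Lb : 1 - r <= Cmod (lin b w) <= 2).
    { generalize (Cmod_lin_ge b w ltac:(lra)) (Cmod_lin_le b w ltac:(lra)). nra. }
    destruct (coef_bounds n) as (Hc & [He He'] & _). assert (Hc1 := coef_le_1 n).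
    assert (Hn := pos_INR n).
    assert (Hd : 0 <= b * INR n * coef n <= INR n).
    { split; [repeat apply Rmult_le_pos; lra |].
      assert (b * coef n <= 1) by nra. nra. }
    rewrite !Cmod_mult, Cmod_opp, Cmod_mult, Cmod_Cexp.
    rewrite Cmod_div by (apply Cmult_neq_0; auto). rewrite !Cmod_mult, Cmod_pow. fold r.
    assert (B1 : exp (Re (RtoC l * (Clog (lin b w) - Clog (lin a w)))%C) <= exp (ln 2 - ln (1 - r))).
    { apply exp_le. rewrite re_scal_l. unfold Clog, Cminus, Cplus, Copp, Re at 1; simpl.
      assert (ln (Cmod (lin b w)) <= ln 2) by (apply ln_le; lra).
      assert (ln (1 - r) <= ln (Cmod (lin a w))) by (apply ln_le; lra).
      (* The exponent is l times a quantity at most ln 2 - ln (1 - r); as this bound is nonnegative,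
         l <= 1 can be replaced by 1. *)
      assert (ln (1 - r) <= ln 2) by (apply ln_le; lra).
      nra. }
    assert (B2 : Cmod w ^ n <= r ^ n) by (apply pow_incr; lra).
    assert (B3 : Cmod (RtoC (coef_defect n) + RtoC (b * INR n * coef n) * lin a w) <= 1 + 2 * INR n).
    { eapply Rle_trans; [apply Cmod_triangle |].
      rewrite Cmod_mult, !Cmod_R, !Rabs_pos_eq by lra.
      assert (b * coef n <= 1) by nra. nra. }
    assert (B4 : / (Cmod (lin a w) * Cmod (lin b w)) <= / ((1 - r) * (1 - r))).
    { apply Rinv_le_contravar; nra. }
    assert (P4 : 0 < / (Cmod (lin a w) * Cmod (lin b w))) by (apply Rinv_0_lt_compat; nra).
    assert (P2 := pow_le _ n Hw0). assert (P3 := Cmod_ge_0 (RtoC (coef_defect n) + RtoC (b * INR n * coef n) * lin a w)).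
    apply Rle_trans with (1 * (exp (ln 2 - ln (1 - r)) * (r ^ n * (1 + 2 * INR n) * / ((1 - r) * (1 - r))))).
    + unfold Rdiv. apply Rmult_le_compat; [lra | | lra |].
      * apply Rmult_le_pos; [apply Rlt_le, exp_pos |]. repeat apply Rmult_le_pos; lra.
      * apply Rmult_le_compat; [apply Rlt_le, exp_pos | | exact B1 |].
        -- repeat apply Rmult_le_pos; lra.
        -- apply Rmult_le_compat; [apply Rmult_le_pos; lra | lra | | exact B4].
           apply Rmult_le_compat; lra.
    + unfold K. apply Req_le. field. lra.
Qed.

(** The error s_n - v equals v (s_n / v - 1), and [psum_div_sub_1_le] makes it a constant times (1 +
    2 n) r^n. The expansion thus follows from the recurrence alone. *)
Lemma coef_power_series (z : C) : in_disk z ->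
  is_pseries (K := C_AbsRing) (V := C_NormedModule) (fun k => RtoC (coef k)) z
    (Cexp (RtoC l * (Clog (lin a z) - Clog (lin b z)))).
Proof.
  intros Hz. set (V := Cexp (RtoC l * (Clog (lin a z) - Clog (lin b z)))).
  set (r := Cmod z). assert (Hr0 : 0 <= r) by apply Cmod_ge_0.
  assert (Hr1 : r < 1) by exact Hz.
  set (K := Cmod V * (exp (ln 2 - ln (1 - r)) / ((1 - r) * (1 - r)))).
  assert (B : forall n, Cmod (psum n z - V) <= K * ((1 + 2 * INR n) * r ^ n)).
  { intros n. set (W := Cexp (RtoC l * (Clog (lin b z) - Clog (lin a z)))).
    assert (E : (V * W)%C = RtoC 1).
    { unfold V, W. rewrite <- Cexp_plus, <- exp_0, <- Cexp_RtoC. f_equal. ring. }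
    replace (psum n z - V)%C with (V * (psum n z * W - 1))%C
      by (transitivity (psum n z * (V * W) - V)%C; [ring | rewrite E; ring]).
    rewrite Cmod_mult. unfold K. rewrite Rmult_assoc. apply Rmult_le_compat_l; [apply Cmod_ge_0 |].
    now apply psum_div_sub_1_le. }
  assert (L : is_lim_seq (fun n => K * ((1 + 2 * INR n) * r ^ n)) 0).
  { replace (Finite 0) with (Rbar_mult K 0) by (simpl; f_equal; ring).
    apply is_lim_seq_scal_l, is_lim_seq_affine_geom; lra. }
  unfold is_pseries, is_series. intros P [eps HP].
  apply is_lim_seq_spec in L. destruct (L eps) as [N HN].
  exists N. intros n Hn. apply HP.
  apply (norm_compat1 (K := C_AbsRing) (V := C_NormedModule)).
  specialize (HN n Hn). rewrite Rminus_0_r in HN.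
  apply Rle_lt_trans with (2 := HN), Rle_trans with (2 := Rle_abs _), Rle_trans with (2 := B n).
  apply Req_le. change (Cmod (sum_n (fun k => scal (pow_n z k) (RtoC (coef k))) n - V) = Cmod (psum n z - V)).
  f_equal. f_equal. apply sum_n_ext. intros k.
  transitivity (z ^ k * RtoC (coef k))%C; [| apply Cmult_comm].
  change (pow_n z k * RtoC (coef k) = z ^ k * RtoC (coef k))%C. f_equal.
Qed.

(** * The root h = (s_n / v)^(1/l) *)

Context (n : nat).

Hint Resolve Re_lin_1_psum_pos psum_neq_0 : core.

(** An analytic logarithm of s_n. The right half-plane is known to contain (1 - z) s_n and 1 - z, so
    the principal logarithm is applied to these two. *)
Definition log_psum (z : C) : C := (Clog (lin 1 z * psum n z) - Clog (lin 1 z))%C.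

Lemma Cexp_log_psum (z : C) : in_disk z -> Cexp (log_psum z) = psum n z.
Proof.
  intros Hz. unfold log_psum. rewrite Cexp_minus, !Cexp_Clog by auto.
  field. auto.
Qed.

Lemma cderiv_log_psum (z : C) : in_disk z ->
  cderiv log_psum z (dpsum n z / psum n z)%C.
Proof.
  intros Hz. eapply cderiv_eq.
  - apply cderiv_minus.
    + apply cderiv_Clog_comp; [now auto |].
      apply (cderiv_mult (lin 1)); [apply cderiv_lin | apply cderiv_psum].
    + apply cderiv_Clog_lin; auto.
  - cbv beta. field. auto.
Qed.

Lemma log_psum_RtoC (r : R) : 0 <= r < 1 -> log_psum (RtoC r) = RtoC (ln (rpsum n r)).
Proof.
  intros Hr. assert (H := rpsum_ge_1 n r ltac:(lra)).
  unfold log_psum. rewrite psum_RtoC.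
  assert (E : lin 1 (RtoC r) = RtoC (1 - r)) by (unfold lin; rewrite RtoC_minus; ring).
  assert (0 < (1 - r) * rpsum n r) by (apply Rmult_lt_0_compat; lra).
  rewrite E, <- RtoC_mult, !Clog_pos by lra.
  rewrite ln_mult by lra. rewrite <- RtoC_minus. f_equal. ring.
Qed.

Lemma log_psum_at_0 : log_psum (RtoC 0) = RtoC 0.
Proof. unfold log_psum. rewrite psum_at_0, lin_0, Cmult_1_l. ring. Qed.

(** The exponential of the left side is |s_n(z)|, at most s_n(|z|) because the coefficients are
    nonnegative. *)
Lemma Re_log_psum_le (z : C) : in_disk z -> Re (log_psum z) <= ln (rpsum n (Cmod z)).
Proof.
  intros Hz.
  rewrite <- (ln_exp (Re (log_psum z))), <- Cmod_Cexp, Cexp_log_psum by assumption.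
  apply ln_le; [apply Cmod_gt_0; auto | apply Cmod_psum_le].
Qed.

(* The l-th root of s_n / v, through which the subordination is realized. *)
Definition log_root (z : C) : C :=
  (RtoC (/ l) * log_psum z + (Clog (lin b z) - Clog (lin a z)))%C.
Definition root (z : C) : C := Cexp (log_root z).

Definition dlog_root (z : C) : C :=
  (RtoC (/ l) * (dpsum n z / psum n z) +
   (- RtoC b / lin b z - - RtoC a / lin a z))%C.

Lemma cderiv_log_root (z : C) : in_disk z -> cderiv log_root z (dlog_root z).
Proof.
  intros Hz. apply (cderiv_plus (fun x => RtoC (/ l) * log_psum x)%C).
  - apply cderiv_scal, cderiv_log_psum, Hz.
  - apply cderiv_minus; apply cderiv_Clog_lin; auto.
Qed.

Definition droot (z : C) : C :=
  (- (RtoC (/ l) * (Cexp (RtoC (/ l - 1) * log_psum z) * (z ^ n *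
    (RtoC (coef_defect n) / (lin a z * lin a z) +
     RtoC (b * INR n * coef n) / lin a z)))))%C.

(** Here h' / h = s_n' / (l s_n) - (b - a) / ((1 - a z) (1 - b z)), and [psum_ode] cancels the last
    term. The factor (1 - b z) / (1 - a z) of h then removes 1 - b z from the denominator, leaving
    [droot]. *)
Lemma cderiv_root (z : C) : in_disk z -> cderiv root z (droot z).
Proof.
  intros Hz. eapply cderiv_eq; [apply (cderiv_Cexp_comp log_root), cderiv_log_root, Hz |].
  assert (Hla : lin a z <> RtoC 0) by auto. assert (Hlb : lin b z <> RtoC 0) by auto.
  assert (Hs : psum n z <> RtoC 0) by auto.
  assert (Hl : RtoC l <> RtoC 0) by (intros E; apply RtoC_inj in E; lra).
  assert (E : Cexp (log_root z) =
    (Cexp (RtoC (/ l - 1) * log_psum z) * psum n z * (lin b z / lin a z))%C).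
  { unfold log_root. rewrite Cexp_plus, Cexp_minus, !Cexp_Clog by auto. f_equal.
    rewrite <- Cexp_log_psum, <- Cexp_plus by assumption. f_equal.
    rewrite RtoC_minus. ring. }
  rewrite E. unfold dlog_root, droot.
  generalize (Cexp (RtoC (/ l - 1) * log_psum z)). intros X.
  assert (O : dpsum n z = ((RtoC (l * (b - a)) * psum n z -
   z ^ n * (RtoC (coef_defect n) + RtoC (b * INR n * coef n) * lin a z)) / (lin a z * lin b z))%C).
  { rewrite <- psum_ode. field. auto. }
  rewrite O, RtoC_inv, RtoC_mult, RtoC_minus by lra.
  generalize (z ^ n)%C. intros Z. unfold lin in *. field. auto.
Qed.

Definition rdroot (r : R) : R :=
  / l * (exp ((/ l - 1) * ln (rpsum n r)) * (r ^ n *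
    (coef_defect n / ((1 - a * r) * (1 - a * r)) + b * INR n * coef n / (1 - a * r)))).

Lemma lin_RtoC (c r : R) : lin c (RtoC r) = RtoC (1 - c * r).
Proof. unfold lin. now rewrite RtoC_minus, RtoC_mult. Qed.

Lemma droot_RtoC (r : R) : 0 <= r < 1 -> droot (RtoC r) = RtoC (- rdroot r).
Proof.
  intros Hr. assert (1 - a * r <> 0) by nra.
  unfold droot, rdroot.
  rewrite log_psum_RtoC, lin_RtoC, <- !RtoC_mult, Cexp_RtoC, <- RtoC_pow by assumption.
  rewrite <- !RtoC_div, <- RtoC_plus, <- !RtoC_mult, <- RtoC_opp; [reflexivity | nra..].
Qed.

Lemma root_RtoC (r : R) : 0 <= r < 1 ->
  root (RtoC r) = RtoC (exp (/ l * ln (rpsum n r)) * ((1 - b * r) / (1 - a * r))).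
Proof.
  intros Hr. unfold root, log_root.
  assert (0 < 1 - a * r) by nra. assert (0 < 1 - b * r) by nra.
  rewrite log_psum_RtoC, !lin_RtoC, Cexp_plus, Cexp_minus, !Cexp_Clog by assumption.
  rewrite <- RtoC_mult, Cexp_RtoC, <- RtoC_div, <- RtoC_mult; [reflexivity | lra].
Qed.

(** Every factor grows when z is replaced by |z|: the power of s_n because its exponent 1/l - 1 is
    nonnegative, and 1 / (1 - a z) because |1 - a z| >= 1 - a |z|. The coefficients e_n and b n c_n
    are nonnegative, so the triangle inequality loses nothing on the axis. *)
Lemma Cmod_droot_le (z : C) : in_disk z -> Cmod (droot z) <= rdroot (Cmod z).
Proof.
  intros Hz. assert (Hm := Cmod_ge_0 z). assert (Hz' := Hz). unfold in_disk in Hz'.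
  assert (Hp : 0 < 1 - a * Cmod z) by nra.
  assert (HL := Cmod_lin_ge a z Ha).
  destruct (coef_bounds n) as (Hc & [He _] & _).
  assert (Hli : 1 <= / l) by (rewrite <- Rinv_1; apply Rinv_le_contravar; lra).
  assert (Hd : 0 <= b * INR n * coef n).
  { repeat apply Rmult_le_pos; try lra. apply pos_INR. }
  unfold droot, rdroot. rewrite Cmod_opp, !Cmod_mult, Cmod_R, Cmod_pow, Rabs_pos_eq by lra.
  apply Rmult_le_compat_l; [lra |].
  apply Rmult_le_compat; [apply Cmod_ge_0 | | |].
  - apply Rmult_le_pos; [now apply pow_le | apply Cmod_ge_0].
  - rewrite Cmod_Cexp, re_scal_l. apply exp_le, Rmult_le_compat_l; [lra |].
    now apply Re_log_psum_le.
  - apply Rmult_le_compat_l; [now apply pow_le |].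
    eapply Rle_trans; [apply Cmod_triangle |].
    rewrite !Cmod_div, Cmod_mult, !Cmod_R, !Rabs_pos_eq by (try apply Cmult_neq_0; auto).
    apply Rplus_le_compat; apply Rmult_le_compat_l; try assumption;
      apply Rinv_le_contravar; nra.
Qed.

Lemma root_at_0 : root (RtoC 0) = RtoC 1.
Proof.
  unfold root, log_root. rewrite log_psum_at_0, !lin_0.
  replace (_ + _)%C with (RtoC 0) by ring. now rewrite Cexp_RtoC, exp_0.
Qed.

Lemma Cmod_root_sub_1_lt (z : C) : in_disk z -> Cmod (root z - 1) < b.
Proof.
  intros Hz. assert (Hm := Cmod_ge_0 z). assert (Hz' := Hz). unfold in_disk in Hz'.
  set (r := Cmod z) in *.
  assert (Hr : in_disk (RtoC r)) by (unfold in_disk; rewrite Cmod_R, Rabs_pos_eq; lra).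
  (* The majorant is t -> - h(t r), whose derivative is r [rdroot] (t r); the right side is 1 -
     h(r). *)
  assert (H : Cmod (root z - root (RtoC 0)) <=
    - Re (root (RtoC 1 * RtoC r)%C) - - Re (root (RtoC 0 * RtoC r)%C)).
  { apply (ray_mean_value root droot z (fun t => - Re (root (RtoC t * RtoC r)%C))
      (fun t => r * rdroot (t * r))).
    - intros t Ht. apply cderiv_root. now apply in_disk_ray.
    - intros t Ht.
      assert (D : cderiv (fun w => root (w * RtoC r)%C) (RtoC t) (RtoC r * droot (RtoC t * RtoC r))%C).
      { apply (cderiv_comp root (fun w => w * RtoC r)%C).
        - apply cderiv_root. now apply in_disk_ray.
        - apply cderiv_eq with (RtoC 1 * RtoC r + RtoC t * RtoC 0)%C; [| ring].
          apply (cderiv_mult (fun w => w) (fun _ => RtoC r)); [apply cderiv_id | apply cderiv_const]. }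
      apply cderiv_real_line in D. destruct D as [D _].
      rewrite <- RtoC_mult, droot_RtoC, re_scal_l, re_RtoC in D by nra.
      replace (r * rdroot (t * r)) with (- (r * - rdroot (t * r))) by ring.
      apply (is_derive_opp (K := R_AbsRing) (V := R_NormedModule)), D.
    - intros t Ht. rewrite Cmod_mult. apply Rmult_le_compat_l; [assumption |].
      eapply Rle_trans; [apply Cmod_droot_le; now apply in_disk_ray |].
      rewrite Cmod_mult, Cmod_R, Rabs_pos_eq by lra. fold r. lra. }
  rewrite Cmult_1_l, Cmult_0_l, root_at_0, root_RtoC, !re_RtoC in H by lra.
  apply Rle_lt_trans with (1 := H).
  assert (H1 : 1 <= exp (/ l * ln (rpsum n r))).
  { rewrite <- exp_0. apply exp_le. apply Rmult_le_pos.
    - apply Rlt_le, Rinv_0_lt_compat, Hl0.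
    - rewrite <- ln_1. apply ln_le; [lra | now apply rpsum_ge_1]. }
  (* After clearing the denominator, the difference is b (1 - r) + a r (1 - b), whose first term is
     positive. With s_n(r) >= 1 this gives h(r) > 1 - b. *)
  assert (H2 : 1 - b < (1 - b * r) / (1 - a * r)).
  { assert (0 < 1 - a * r) by nra. apply Rmult_lt_reg_r with (1 - a * r); [assumption |].
    unfold Rdiv. rewrite Rmult_assoc, Rinv_l, Rmult_1_r by lra.
    assert (0 <= a * r * (1 - b)) by (repeat apply Rmult_le_pos; lra). nra. }
  nra.
Qed.

Lemma Re_root_pos (z : C) : in_disk z -> 0 < Re (root z).
Proof.
  intros Hz. assert (H := Cmod_root_sub_1_lt z Hz).
  assert (E : Re (root z - 1)%C = Re (root z) - 1) by (unfold Re; simpl; ring).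
  generalize (re_le_Cmod (root z - 1)) (Rabs_maj2 (Re (root z - 1)%C)). rewrite E. lra.
Qed.

(** Since |h - 1| < b <= 1, h stays in the right half-plane and [log_root] is its principal
    logarithm; the principal l-th power of h is therefore s_n / v. *)
Lemma Clog_root (z : C) : in_disk z -> Clog (root z) = log_root z.
Proof.
  apply (Clog_Cexp_disk log_root dlog_root).
  - exact cderiv_log_root.
  - unfold log_root. rewrite log_psum_at_0, !lin_0. ring.
  - exact Re_root_pos.
Qed.

End PartialSums.

(** * Stability and the subordinating function *)

Theorem theorem3 (l A B : R) (hl0 : 0 < l) (hl1 : l <= 1)
    (hB : -1 <= B) (hBA : B < A) (hA : A <= 0) :
  (forall z : C, in_disk z ->
     v l 0 B z = (1 / Cpowr (1 + RtoC B * z) l)%C) /\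
  stable (v l A B) (v l 0 B).
Proof.
  set (a := - A). set (b := - B).
  assert (EA : A = - a) by (unfold a; ring). assert (EB : B = - b) by (unfold b; ring).
  assert (Ha : 0 <= a) by lra. assert (Hab : a < b) by lra. assert (Hb : b <= 1) by lra.
  clearbody a b. subst A B.
  assert (G : forall z, in_disk z -> v l 0 (- b) z = (1 / Cpowr (lin b z) l)%C).
  (* The parameter 0 is read as [- 0] to fit [v_eq_Cexp]; the numerator [lin 0 z] is 1 and
     contributes no logarithm. *)
  { intros z Hz. rewrite <- Ropp_0 at 1. rewrite v_eq_Cexp by (assumption || lra).
    assert (E : lin 0 z = RtoC 1) by (unfold lin; ring).
    unfold Cpowr. rewrite E, Clog_1. unfold Cdiv. rewrite Cmult_1_l, <- Cexp_opp. f_equal. ring. }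
  assert (F : forall z, in_disk z ->
    v l (- a) (- b) z = Cexp (RtoC l * (Clog (lin a z) - Clog (lin b z)))).
  { intros z Hz. apply v_eq_Cexp; (assumption || lra). }
  assert (Pnz : forall z, Cpowr (lin b z) l <> RtoC 0) by (intros z; apply Cexp_neq_0).
  assert (D0 : in_disk (RtoC 0)) by (unfold in_disk; rewrite Cmod_0; lra).
  assert (DG : analytic_on_disk (fun z => Cpowr (lin b z) l)).
  { intros z Hz. eexists. apply (cderiv_Cexp_comp (fun z => RtoC l * Clog (lin b z))%C).
    apply cderiv_scal, cderiv_Clog_lin; [lra | exact Hz]. }
  split.
  { intros z Hz. rewrite G by assumption. now rewrite one_plus_opp. }
  intros n _. split; [| split].
  - split.
    + intros z Hz. eexists. apply (cderiv_ext_disk (fun z => Cexp (RtoC l * (Clog (lin a z) - Clog (lin b z))))).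
      * intros x Hx. now rewrite F.
      * exact Hz.
      * apply cderiv_Cexp_comp, cderiv_scal, cderiv_minus; apply cderiv_Clog_lin; (exact Hz || lra).
    + rewrite F, !lin_0, Clog_1 by exact D0. unfold Cminus. rewrite Cplus_opp_r, Cmult_0_r, Cexp_RtoC, exp_0. reflexivity.
  - split.
    + intros z Hz. eexists. apply (cderiv_ext_disk (fun z => Cexp (- RtoC l * Clog (lin b z)))).
      * intros x Hx. rewrite G by assumption. unfold Cpowr, Cdiv. rewrite Cmult_1_l, <- Cexp_opp. f_equal. ring.
      * exact Hz.
      * apply cderiv_Cexp_comp, cderiv_scal, cderiv_Clog_lin; (exact Hz || lra).
    + rewrite G by exact D0. unfold Cpowr. rewrite lin_0, Clog_1, Cmult_0_r, Cexp_RtoC, exp_0. field.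
  - exists (fun k => RtoC (coef l a b k)). split.
    { intros z Hz. rewrite F by assumption. now apply coef_power_series. }
    split; [| split].
    + intros z Hz. eexists.
      apply (cderiv_ext_disk (psum_div l a b n)).
      * intros x Hx. rewrite F by assumption. unfold Cdiv. rewrite <- Cexp_opp. unfold psum_div, psum. f_equal. f_equal. ring.
      * exact Hz.
      * now apply cderiv_psum_div.
    + intros z Hz. destruct (DG z Hz) as [d Hd]. exists d.
      apply (cderiv_ext_disk (fun z => Cpowr (lin b z) l)); [| exact Hz | exact Hd].
      intros x Hx. rewrite G by assumption. field. apply Pnz.
    (* As 1 / v_l(0, -b) is (1 - b w)^l, the witness is the solution of 1 - b w = h; then |w| < 1
       amounts to |h - 1| < b. *)
    + exists (fun z => RtoC (/ b) * (RtoC 1 - root l a b n z))%C.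
      assert (Hw : forall z, in_disk z -> Cmod (RtoC (/ b) * (RtoC 1 - root l a b n z)) < 1).
      { intros z Hz. assert (H := Cmod_root_sub_1_lt l a b hl0 hl1 Ha Hab Hb n z Hz).
        replace (RtoC 1 - root l a b n z)%C with (- (root l a b n z - 1))%C by ring.
        rewrite Cmod_mult, Cmod_opp, Cmod_R, Rabs_pos_eq by (apply Rlt_le, Rinv_0_lt_compat; lra).
        apply Rmult_lt_reg_l with b; [lra |]. rewrite <- Rmult_assoc, Rinv_r by lra. lra. }
      split; [| split; [| split]].
      * intros z Hz. eexists. apply cderiv_scal.
        apply (cderiv_minus (fun _ => RtoC 1)); [apply cderiv_const |]. now apply cderiv_root.
      * rewrite root_at_0. ring.
      * exact Hw.
      * intros z Hz. rewrite F, G by (try apply Hw; assumption).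
        assert (E : lin b (RtoC (/ b) * (RtoC 1 - root l a b n z)) = root l a b n z).
        { unfold lin. rewrite RtoC_inv by lra. field. intros E; apply RtoC_inj in E; lra. }
        assert (X : partial_sum (fun k => RtoC (coef l a b k)) n z = Cexp (log_psum l a b n z)).
        { symmetry. now apply Cexp_log_psum. }
        (* Both sides become exponentials, and l [log_root] is the logarithm of s_n minus that of
           v. *)
        unfold Cpowr. rewrite E, Clog_root, X by assumption.
        rewrite <- Cexp_minus.
        transitivity (Cexp (RtoC l * log_root l a b n z)).
        { f_equal. unfold log_root. rewrite RtoC_inv by lra. field. intros E'; apply RtoC_inj in E'; lra. }
        field. apply Cexp_neq_0.
Qed.
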